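(* Let $(\mathcal{D},\mathcal{A},C,\mathbb{V})$ be a QIF-game over finite sets $\mathcal{X},\mathcal{Y}$ with prior $\pi\in\mathbb{D}\mathcal{X}$. The minimax problem $\delta^*=\operatorname{argmin}_{\delta\in\mathbb{D}\mathcal{D}}\max_{\alpha\in\mathbb{D}\mathcal{A}}\mathbb{V}(\delta,\alpha)$ is equivalent to $$\delta^*=\operatorname{argmin}_{\delta\in\mathbb{D}\mathcal{D}} f(\delta),\qquad\text{where } f(\delta)=\max_{a\in\mathcal{A}}\mathbb{V}\Bigl[\pi,\sum_{d}\delta(d)C_{da}\Bigr];$$ that is, $\delta^*\in\mathbb{D}\mathcal{D}$ is a minimizer of $\delta\mapsto\max_{\alpha}\mathbb{V}(\delta,\alpha)$ if and only if it is a minimizer of $f$ over $\mathbb{D}\mathcal{D}$.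
   Context: For a finite set $\mathcal{I}$, $\mathbb{D}\mathcal{I}$ denotes the set of all probability distributions on $\mathcal{I}$. A channel $C:\mathcal{X}\times\mathcal{Y}\to\mathbb{R}$ (with $\mathcal{X},\mathcal{Y}$ finite) satisfies $0\le C(x,y)\le 1$ and $\sum_{y}C(x,y)=1$ for every $x$. A vulnerability measure is a continuous convex function $\mathbb{V}:\mathbb{D}\mathcal{X}\to\mathbb{R}$. For a prior $\pi\in\mathbb{D}\mathcal{X}$ and a channel $C$, let $p(x,y)=\pi(x)C(x,y)$, $p(y)=\sum_x p(x,y)$ and, if $p(y)\neq 0$, $p_{X\mid y}(x)=p(x,y)/p(y)$. The posterior vulnerability is $\mathbb{V}[\pi,C]=\sum_{y:\,p(y)>0}p(y)\,\mathbb{V}(p_{X\mid y})$. A QIF-game $(\mathcal{D},\mathcal{A},C,\mathbb{V})$ consists of nonempty finite sets $\mathcal{D}$ (the defender's actions) and $\mathcal{A}$ (the attacker's actions), a family $C=\{C_{da}\}_{d\in\mathcal{D},a\in\mathcal{A}}$ of channels all of the same type $\mathcal{X}\times\mathcal{Y}\to\mathbb{R}$, and a vulnerability measure $\mathbb{V}$. Mixed strategies are $\delta\in\mathbb{D}\mathcal{D}$ for the defender and $\alpha\in\mathbb{D}\mathcal{A}$ for the attacker. The utility (maximized by the attacker, minimized by the defender) is $$\mathbb{V}(\delta,\alpha)=\sum_{a}\alpha(a)\,\mathbb{V}\Bigl[\pi,\sum_{d}\delta(d)C_{da}\Bigr],$$ where the sum of channels is entrywise. *)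

(* Defs.v *)
From HB Require Import structures.
From mathcomp Require Import all_boot all_order all_algebra.
From mathcomp Require Import all_classical all_reals all_analysis.

Set Implicit Arguments.
Unset Strict Implicit.
Unset Printing Implicit Defensive.

Import Order.TTheory GRing.Theory Num.Theory.
Import numFieldNormedType.Exports.

Local Open Scope classical_set_scope.
Local Open Scope ring_scope.

(* The simplex DI over a finite set I, as a subset of the functions I -> R. *)
Definition dist (R : realType) (I : finType) : set (I -> R) :=
  [set p | (forall i, 0 <= p i) /\ \sum_i p i = 1].
Arguments dist : clear implicits.

Definition is_channel (R : realType) (X Y : finType) (K : X -> Y -> R) : Prop :=
  (forall x y, 0 <= K x y <= 1) /\ (forall x, \sum_y K x y = 1).

(* A vulnerability measure DX -> R is given by a function on all of X -> R of
   which only the values on the simplex matter.  The simplex has the topology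
   induced by pointwise convergence, which is the Euclidean one, X being
   finite. *)
Definition is_vulnerability (R : realType) (X : finType)
    (V : (X -> R) -> R) : Prop :=
  {within (dist R X : set {ptws X -> R}),
     continuous (V : {ptws X -> R} -> R)} /\
  convex_function (dist R X) V.

Section Posterior.
Variables (R : realType) (X Y : finType).
Variables (V : (X -> R) -> R) (pi : X -> R) (K : X -> Y -> R).

Definition joint (x : X) (y : Y) : R := pi x * K x y.

Definition marginal (y : Y) : R := \sum_x joint x y.

Definition posterior (y : Y) (x : X) : R := joint x y / marginal y.

Definition posterior_vuln : R :=
  \sum_(y | 0 < marginal y) marginal y * V (posterior y).

End Posterior.

Definition mixed_channel (R : realType) (D A X Y : finType)
    (C : D -> A -> X -> Y -> R) (delta : D -> R) (a : A) : X -> Y -> R :=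
  fun x y => \sum_d delta d * C d a x y.

Definition utility (R : realType) (D A X Y : finType)
    (C : D -> A -> X -> Y -> R) (V : (X -> R) -> R) (pi : X -> R)
    (delta : D -> R) (alpha : A -> R) : R :=
  \sum_a alpha a * posterior_vuln V pi (mixed_channel C delta a).

Definition maxima (R : realType) (S : set R) : set R := S `&` ubound S.

(* The greatest element of F @` S; it defaults to 0 when there is none. *)
Definition max_over (R : realType) (T : Type) (S : set T) (F : T -> R) : R :=
  xget 0 (maxima (F @` S)).

Definition argmin (R : realType) (T : Type) (S : set T) (F : T -> R) : set T :=
  [set x | S x /\ forall y, S y -> F x <= F y].

(* Main.v *)
(* For fixed delta the utility is an average, with weights alpha, of the numbers
   V[pi, sum_d delta(d) C_da]; such an average is at most the largest of them,
   and the point mass at an optimal action attains it.  So the two objectives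
   agree at every delta. *)

Require Import Defs.
From mathcomp Require Import all_boot all_order all_algebra.
From mathcomp Require Import all_classical all_reals all_analysis.

Set Implicit Arguments.
Unset Strict Implicit.
Unset Printing Implicit Defensive.

Import Order.TTheory GRing.Theory Num.Theory.

Local Open Scope classical_set_scope.
Local Open Scope ring_scope.

(** Greatest elements are unique by antisymmetry, and exhibiting one rules out the default value 0
    of [xget]. *)
Lemma max_overE (R : realType) (T : Type) (S : set T) (F : T -> R) (m : R) :
  maxima (F @` S) m -> max_over S F = m.
Proof.
move=> [Sm ubm]; rewrite /max_over; case: xgetP => [y _ [Sy uby]|noM].
  by apply/eqP; rewrite eq_le ubm //= uby.
by case: (noM m); split.
Qed.

Lemma maxima_image (R : realType) (T : Type) (S : set T) (F : T -> R) (x : T) :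
  S x -> (forall y, S y -> F y <= F x) -> maxima (F @` S) (F x).
Proof. by move=> Sx le_x; split=> [|_ [y Sy <-]]; [exists x | exact: le_x]. Qed.

Lemma dist_dirac (R : realType) (I : finType) (i : I) :
  dist R I (fun j => (j == i)%:R).
Proof.
split=> [j|]; first exact: ler0n.
by rewrite (bigD1 i) //= eqxx big1 ?addr0 // => j /negPf ->.
Qed.

Lemma sum_dirac (R : realType) (I : finType) (g : I -> R) (i : I) :
  \sum_j (j == i)%:R * g j = g i.
Proof.
by rewrite (bigD1 i) //= eqxx mul1r big1 ?addr0 // => j /negPf ->; rewrite mul0r.
Qed.

(** The weights sum to 1, so [m] is itself the average of the constant [m]; nonnegative weights then
    allow a termwise comparison. *)
Lemma dist_average_le (R : realType) (I : finType) (g p : I -> R) (m : R) :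
  dist R I p -> (forall i, g i <= m) -> \sum_i p i * g i <= m.
Proof.
move=> [p_ge0 p_sum1] g_le; rewrite -[leRHS]mul1r -p_sum1 mulr_suml.
by apply: ler_sum => i _; apply: ler_wpM2l.
Qed.

(** Sharing one [m] yields at once that both maxima exist and that they coincide. It is the value of
    [g] at a maximizing index, available because [I] is finite and nonempty. *)
Lemma maxima_average (R : realType) (I : finType) (g : I -> R) :
  (0 < #|I|)%N -> exists m,
    maxima [set \sum_i p i * g i | p in dist R I] m /\
    maxima [set g i | i in [set: I]] m.
Proof.
move=> /card_gt0P [i0 _].
case: (@Order.TotalTheory.arg_maxP _ _ _ i0 xpredT g isT) => i _ g_le.
exists (g i); split; last by apply: maxima_image => // j _; exact: g_le.
(* Writing [g i] as the average under the point mass at [i] makes that point mass the maximizer over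
   the simplex. *)
rewrite -[X in maxima _ X](sum_dirac g i).
apply: (maxima_image (F := fun p : I -> R => \sum_j p j * g j)).
  exact: dist_dirac.
by move=> p Dp; rewrite sum_dirac; apply: dist_average_le => // j; exact: g_le.
Qed.

Theorem proposition6 (R : realType) (D A X Y : finType)
  (D_gt0 : (0 < #|D|)%N) (A_gt0 : (0 < #|A|)%N)
  (C : D -> A -> X -> Y -> R) (C_channel : forall d a, is_channel (C d a))
  (V : (X -> R) -> R) (V_vuln : is_vulnerability V)
  (pi : X -> R) (pi_dist : dist R X pi) :
  let f := fun delta : D -> R =>
    max_over [set: A]
      (fun a => posterior_vuln V pi (mixed_channel C delta a)) in
  (* both maxima exist *)
  (forall delta, dist R D delta ->
     maxima [set utility C V pi delta alpha | alpha in dist R A] !=set0 /\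
     maxima [set posterior_vuln V pi (mixed_channel C delta a)
            | a in [set: A]] !=set0) /\
  (forall delta_star : D -> R,
     argmin (dist R D)
       (fun delta => max_over (dist R A) (utility C V pi delta)) delta_star
     <-> argmin (dist R D) f delta_star).
Proof.
move=> f.
have maxE delta := maxima_average
  (fun a => posterior_vuln V pi (mixed_channel C delta a)) A_gt0.
split=> [delta _|delta_star].
  by have [m [util_m vuln_m]] := maxE delta; split; exists m.
(* [maxE] holds for every [delta], on or off the simplex, so the objectives are equal as functions
   and the argmin sets are literally the same. *)
suff -> : (fun delta => max_over (dist R A) (utility C V pi delta)) = f by [].
apply/funext => delta; have [m [util_m vuln_m]] := maxE delta.
by rewrite /f (max_overE vuln_m); apply: max_overE.
Qed.
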